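(* Let $\mathbf M\in\mathbb S^n_{++}$. The Riemannian distance on $\mathcal M_{\rm gbw}$ between any $\mathbf X,\mathbf Y\in\mathbb S^n_{++}$ is $$d_{\rm gbw}(\mathbf X,\mathbf Y)=\Big(\operatorname{tr}(\mathbf M^{-1}\mathbf X)+\operatorname{tr}(\mathbf M^{-1}\mathbf Y)-2\operatorname{tr}\big((\mathbf X\mathbf M^{-1}\mathbf Y\mathbf M^{-1})^{1/2}\big)\Big)^{1/2}.$$
   Context: $\mathbb S^n$ is the space of real symmetric $n\times n$ matrices and $\mathbb S^n_{++}$ the open subset of positive definite ones. For $\mathbf X,\mathbf M\in\mathbb S^n_{++}$ and $\mathbf U\in\mathbb S^n$, $\mathcal L_{\mathbf X,\mathbf M}[\mathbf U]$ is the unique solution $\mathbf L$ of $\mathbf X\mathbf L\mathbf M+\mathbf M\mathbf L\mathbf X=\mathbf U$. $\mathcal M_{\rm gbw}$ is the manifold $\mathbb S^n_{++}$ with the generalized Bures-Wasserstein metric $g_{\rm gbw}(\mathbf U,\mathbf V)=\frac12\operatorname{tr}(\mathcal L_{\mathbf X,\mathbf M}[\mathbf U]\mathbf V)$ at $\mathbf X$, $\mathbf U,\mathbf V\in T_{\mathbf X}\mathbb S^n_{++}=\mathbb S^n$. The Riemannian distance is the infimum of lengths of piecewise smooth curves joining the two points. For a product $\mathbf B$ of two symmetric positive definite matrices, $\mathbf B^{1/2}$ is its principal square root (the unique square root with positive eigenvalues). *)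

(* Defs.v *)
From HB Require Import structures.
From mathcomp Require Import all_boot all_order all_algebra.
From mathcomp Require Import sesquilinear.
From mathcomp Require Import complex.
From mathcomp Require Import all_classical all_reals all_analysis.

Set Implicit Arguments.
Unset Strict Implicit.
Unset Printing Implicit Defensive.

Import Order.TTheory GRing.Theory Num.Theory.
Import numFieldNormedType.Exports.

Local Open Scope classical_set_scope.
Local Open Scope ring_scope.

Section Defs.
Variables (R : realType) (n : nat).
Implicit Types (A B M X Y U V L Q : 'M[R]_n) (c : R -> 'M[R]_n).

Definition spd A : Prop :=
  A \is symmetricmx /\
  forall v : 'cV[R]_n, v != 0 -> 0 < (v^T *m A *m v) 0 0.

(* The equation has exactly one solution when [X] and [M] are positive
   definite; [0] is the default value in the other cases. *)
Definition lyapunov X M U : 'M[R]_n :=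
  xget 0 [set L | X *m L *m M + M *m L *m X = U].

Definition gbw_metric M X U V : R := 2^-1 * \tr (lyapunov X M U *m V).

(* A real matrix may have non-real eigenvalues, so the spectrum is taken
   over [R[i]], where [0 < z] says that [z] is real and positive. *)
Definition is_principal_sqrt B Q : Prop :=
  Q *m Q = B /\
  forall z : R[i], eigenvalue (map_mx (real_complex R) Q) z -> 0 < z.

Definition principal_sqrt B : 'M[R]_n := xget 0 [set Q | is_principal_sqrt B Q].

(* Smoothness on a closed interval, in the usual sense that the curve extends
   to a C^oo map on an open neighbourhood of that interval. *)
Definition smooth_on_segment (a b : R) c : Prop :=
  exists (O : set R) (f : R -> 'M[R]_n),
    [/\ open O, `[a, b] `<=` O,
        forall t, t \in `[a, b] -> f t = c t &
        forall (k : nat) (t : R), O t -> derivable (derive1n k f) t 1].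

(* [0 :: s] lists the subdivision points 0 = t_0 < ... < t_k = 1.  Consecutive
   segments share an endpoint, so such a curve is continuous on [0, 1]. *)
Definition piecewise_smooth c : Prop :=
  exists2 s : seq R, itv_partition 0 1 s &
    forall i : nat, (i < size s)%N ->
      smooth_on_segment (nth 0 (0 :: s) i) (nth 0 (0 :: s) i.+1) c.

(* The derivative is irrelevant at the finitely many points where the curve
   need not be differentiable: they form a null set. *)
Definition curve_length (g : 'M[R]_n -> 'M[R]_n -> 'M[R]_n -> R) c : \bar R :=
  (\int[lebesgue_measure]_(t in `[0%R, 1%R])
     (Num.sqrt (g (c t) ('D_1 c t) ('D_1 c t)))%:E)%E.

Definition spd_curve X Y c : Prop :=
  [/\ piecewise_smooth c, (forall t, t \in `[0, 1] -> spd (c t)), c 0 = X & c 1 = Y].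

Definition riemannian_dist (g : 'M[R]_n -> 'M[R]_n -> 'M[R]_n -> R) X Y
    : \bar R :=
  ereal_inf [set curve_length g c | c in spd_curve X Y].

Definition gbw_dist M X Y : \bar R := riemannian_dist (gbw_metric M) X Y.

End Defs.

(* Main.v *)
Require Import Defs.
From HB Require Import structures.
From mathcomp Require Import all_boot all_order all_algebra.
From mathcomp Require Import sesquilinear spectral complex ring lra.
From mathcomp Require Import all_classical all_reals all_analysis.
From mathcomp Require Import measurable_realfun.

(** Let [H] be the positive definite solution of [H X H = M^-1 Y M^-1]; then
    [X H] is the principal square root of [X M^-1 Y M^-1], and with
    [E = H - M^-1] the square of the claimed distance is [tr (E X E M)].

    Upper bound: along [c(t) = M G_t X G_t M], where [G_t = M^-1 + t E], the
    solution of the Lyapunov equation at [c'(t)] is [M^-1 G_t^-1 E], so the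
    squared speed is constantly [tr (E X E M)].

    Lower bound: the matrices [A_s = M^-1 G_s^-1 E] solve the Hamilton-Jacobi
    equation [A' = - A M A].  Along a curve of speed [l] and length [Lam], let
    [s] grow at the rate [m = (l + e) / K], with [K = Lam + e], so that it runs
    over [[0, 1]].  Expanding [0 <= tr ((L - m A) c (L - m A) M)] shows that
    [tr (c A_s)] has derivative at most [K l], whence
    [tr (E X E M) = tr (Y A_1) - tr (X A_0) <= K Lam]; let [e] tend to 0. *)

Set Implicit Arguments.
Unset Strict Implicit.
Unset Printing Implicit Defensive.

Import Order.TTheory GRing.Theory Num.Theory.
Import numFieldNormedType.Exports.

Local Open Scope ring_scope.

(** * Square roots of positive definite matrices *)

Section DiagonalizableSquareRoot.
Variables (C : numClosedFieldType) (n : nat) (V : 'M[C]_n) (d : 'rV[C]_n).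
Hypothesis Vu : V \in unitmx.
Let Q0 := invmx V *m diag_mx d *m V.

Let rowVQ0 i : row i V *m Q0 = d 0 i *: row i V.
Proof.
rewrite -row_mul /Q0 !mulmxA mulmxV// mul1mx.
by rewrite row_mul row_diag_mx -scalemxAl -rowE.
Qed.

Lemma eigenvalue_conj_diag z : eigenvalue Q0 z -> exists i, z = d 0 i.
Proof.
move=> /eigenvalueP[v vQ v0].
have w0 : v *m invmx V != 0.
  by apply: contra_neq v0 => /(congr1 (mulmx^~ V)); rewrite mulmxKV// mul0mx.
have /rV0Pn[i wi] := w0; exists i.
have : (v *m invmx V) *m diag_mx d = z *: (v *m invmx V).
  by rewrite scalemxAl -vQ /Q0 !mulmxA mulmxK.
move=> /rowP/(_ i); rewrite mul_mx_diag !mxE mulrC => /(mulIf _)-> //.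
by move: wi; rewrite mxE.
Qed.

(* [E = Q - Q0] satisfies [Q0 E = - E Q], so [E] maps a [Q0]-eigenvector for
   [d i > 0] to a vector that would be a [Q]-eigenvector for [- d i < 0]. *)
Lemma pos_sqrt_unique (Q : 'M[C]_n) : (forall i, 0 < d 0 i) ->
  (forall z, eigenvalue Q z -> 0 < z) -> Q *m Q = Q0 *m Q0 -> Q = Q0.
Proof.
move=> d0 Qpos QQ; apply/eqP; rewrite -subr_eq0; set E := Q - Q0.
have EQ : E *m Q = - (Q0 *m E).
  by rewrite /E mulmxBl mulmxBr QQ opprB.
have VE : V *m E = 0.
  apply/row_matrixP => i; rewrite row0 row_mul.
  apply/eqP/negPn/negP => wE0.
  have : eigenvalue Q (- d 0 i).
    apply/eigenvalueP; exists (row i V *m E) => //.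
    by rewrite -mulmxA EQ mulmxN mulmxA rowVQ0 -scalemxAl scaleNr.
  by move=> /Qpos; rewrite oppr_gt0 => /(lt_trans (d0 i)); rewrite ltxx.
by rewrite -(mulKmx Vu E) VE mulmx0.
Qed.

End DiagonalizableSquareRoot.

Lemma invmx_mul (F : comUnitRingType) n (A B : 'M[F]_n) :
  A \in unitmx -> B \in unitmx ->
  invmx (A *m B) = invmx B *m invmx A.
Proof.
move=> Au Bu; have ABu : A *m B \in unitmx by rewrite unitmx_mul Au.
by rewrite -[RHS](mulmxK ABu) !mulmxA mulmxKV// mulVmx// mul1mx.
Qed.

Section Spd.
Variables (R : realType).
Local Notation cplx := (map_mx (real_complex R)).

Lemma spd_tr n (A : 'M[R]_n) : spd A -> A^T = A.
Proof. by case=> /is_hermitianmxP; rewrite expr0 scale1r map_mx_id// => ->. Qed.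

Lemma spdI n (A : 'M[R]_n) : A^T = A ->
  (forall v : 'cV[R]_n, v != 0 -> 0 < (v^T *m A *m v) 0 0) -> spd A.
Proof.
by move=> AT Ap; split=> //; apply/is_hermitianmxP; rewrite expr0 scale1r map_mx_id.
Qed.

Lemma spd_ge0 n (A : 'M[R]_n) (v : 'cV[R]_n) : spd A -> 0 <= (v^T *m A *m v) 0 0.
Proof.
move=> [_ Ap]; have [->|/Ap/ltW//] := eqVneq v 0.
by rewrite mulmx0 mxE.
Qed.

Lemma spd_unit n (A : 'M[R]_n) : spd A -> A \in unitmx.
Proof.
move=> sA; rewrite -row_free_unit -kermx_eq0.
apply/negPn/negP => /rowV0Pn[v /sub_kermxP vA v0].
have := sA.2 v^T; rewrite trmxK vA mul0mx mxE ltxx => /(_ _).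
by rewrite -(inj_eq trmx_inj) trmxK trmx0 v0 => /(_ isT).
Qed.

Lemma spd_congr n (A P : 'M[R]_n) : spd A -> P \in unitmx -> spd (P^T *m A *m P).
Proof.
move=> sA Pu; apply: spdI.
  by rewrite !trmx_mul trmxK (spd_tr sA) mulmxA.
move=> v v0; have := sA.2 (P *m v); rewrite trmx_mul !mulmxA => -> //.
by apply: contra_neq v0 => Pv; rewrite -(mulKmx Pu v) Pv mulmx0.
Qed.

Lemma spd_inv n (A : 'M[R]_n) : spd A -> spd (invmx A).
Proof.
move=> sA; have Au := spd_unit sA.
have -> : invmx A = (invmx A)^T *m A *m invmx A.
  by rewrite trmx_inv (spd_tr sA) mulVmx// mul1mx.
by apply: spd_congr => //; rewrite unitmx_inv.
Qed.

Lemma spd_segment n (A B : 'M[R]_n) (t : R) : spd A -> spd B -> 0 <= t <= 1 ->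
  spd ((1 - t) *: A + t *: B).
Proof.
move=> sA sB /andP[t0 t1]; apply: spdI.
  by rewrite linearD/= !linearZ/= (spd_tr sA) (spd_tr sB).
move=> v v0; rewrite mulmxDr mulmxDl -!scalemxAr -!scalemxAl !mxE.
have := sA.2 v v0; have := sB.2 v v0; rewrite !mxE.
set a := \sum_i _; set b := \sum_i _ => b0 a0.
have [->|tn0] := eqVneq t 0; first by rewrite subr0 mul1r mul0r addr0.
rewrite ltr_wpDl// ?mulr_ge0// ?subr_ge0// ?(ltW a0) ?(ltW b0)//.
by rewrite mulr_gt0// lt_def tn0.
Qed.


Lemma quad_ge0 n (A : 'M[R]_n) (v : 'rV[R]_n) : spd A -> 0 <= (v *m A *m v^T) 0 0.
Proof. by move=> sA; rewrite -{1}(trmxK v) spd_ge0. Qed.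

Lemma quad_gt0 n (A : 'M[R]_n) (v : 'rV[R]_n) : spd A -> v != 0 ->
  0 < (v *m A *m v^T) 0 0.
Proof.
move=> sA v0; rewrite -{1}(trmxK v) sA.2//.
by rewrite -(inj_eq trmx_inj) trmxK trmx0.
Qed.

(** Write [w = a + i b] with [a] and [b] real. By symmetry of [A] the cross terms cancel, which
    leaves [a A a^T + b A b^T]. This makes complex eigenvectors of a real matrix accessible to real
    positivity. *)
Lemma spdC_gt0 n (A : 'M[R]_n) (w : 'rV[R[i]]_n) : spd A -> w != 0 ->
  0 < (w *m cplx A *m (map_mx (@conjc R) w)^T) 0 0.
Proof.
move=> sA w0.
pose a := map_mx (@complex.Re R) w; pose b := map_mx (@complex.Im R) w.
have q (x y : 'rV[R]_n) : (x *m A *m y^T) 0 0 = (y *m A *m x^T) 0 0.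
  by rewrite -{1}(trmxK x) -{1}(spd_tr sA) -!trmx_mul mulmxA [LHS]mxE.
have wE : w = cplx a + 'i%C *: cplx b.
  by apply/rowP => j; rewrite !mxE -complexE.
have wcE : map_mx (@conjc R) w = cplx a - 'i%C *: cplx b.
  by apply/rowP => j; rewrite !mxE; case: (w 0 j) => x y; simpc.
clearbody a b.
have -> : (w *m cplx A *m (map_mx (@conjc R) w)^T) 0 0 =
    ((a *m A *m a^T) 0 0 + (b *m A *m b^T) 0 0)%:C%C.
  rewrite wcE linearB/= linearZ/= !map_trmx {1}wE.
  rewrite mulmxBr !mulmxDl -!scalemxAr -!scalemxAl -!map_mxM.
  have := q a b.
  move: (a *m A *m a^T) (b *m A *m b^T) (a *m A *m b^T) (b *m A *m a^T).
  move=> aa bb ab ba abE; rewrite !mxE abE; clear abE.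
  rewrite rmorphD /=.
  move: (ba 0 0)%:C%C (aa 0 0)%:C%C (bb 0 0)%:C%C => x y z.
  have := sqr_i R; move: 'i%C => i i2.
  by rewrite opprD (mulrA i i) -expr2 i2 mulN1r opprK addrA addrK.
rewrite ltcR.
have [a0|a0] := eqVneq a 0.
  have [b0|b0] := eqVneq b 0.
    by move: w0; rewrite wE a0 b0 !map_mx0 scaler0 addr0 eqxx.
  by rewrite ltr_wpDl ?quad_ge0 ?quad_gt0.
by rewrite ltr_pwDl ?quad_ge0 ?quad_gt0.
Qed.

Lemma spd_eigenvalue_gt0 n (A : 'M[R]_n) z :
  spd A -> eigenvalue (cplx A) z -> 0 < z.
Proof.
move=> sA /eigenvalueP[v vA v0].
have := spdC_gt0 sA v0; rewrite vA -scalemxAl mxE.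
suff : 0 < (v *m (map_mx (@conjc R) v)^T) 0 0 by move=> h; rewrite pmulr_lgt0.
(* The squared norm of [v] is positive by the same lemma, applied to the identity matrix. *)
have := @spdC_gt0 _ 1%:M v _ v0; rewrite map_mx1 mulmx1; apply.
apply: spdI; first by rewrite trmx1.
move=> u /cV0Pn[i ui]; rewrite mulmx1 mxE.
rewrite (bigD1 i)//= mxE ltr_wpDr//; last by rewrite -expr2 exprn_even_gt0.
by apply: sumr_ge0 => j _; rewrite mxE -expr2 sqr_ge0.
Qed.

(** The complexification is Hermitian, hence normal, and the spectral theorem applies; row [i] of
    [V] is a left eigenvector for [d 0 i]. *)
Lemma symmetric_diag n (A : 'M[R]_n) : A^T = A ->
  exists V : 'M[R[i]]_n, exists d : 'rV_n,
  [/\ V \is unitarymx, forall i, eigenvalue (cplx A) (d 0 i)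
    & cplx A = invmx V *m diag_mx d *m V].
Proof.
move=> symA; exists (spectralmx (cplx A)), (spectral_diag (cplx A)).
have AE : cplx A = invmx (spectralmx (cplx A)) *m
    diag_mx (spectral_diag (cplx A)) *m spectralmx (cplx A).
  apply/orthomx_spectralP/symmetric_normalmx.
    apply/is_hermitianmxP; rewrite expr0 scale1r map_mx_id//.
    by rewrite map_trmx symA.
  by apply/mxOverP => i j; rewrite mxE; apply/complex_realP; exists (A i j).
have Vu := spectral_unitarymx (cplx A).
split=> // i.
apply/eigenvalueP; exists (row i (spectralmx (cplx A))); last first.
  (* A zero row would make the determinant of the unitary matrix vanish. *)
  apply: contraTneq (spectral_unit (cplx A)) => r0.
  rewrite unitmxE (expand_det_row _ i) big1 ?unitr0// => j _.
  by move/rowP : r0 => /(_ j); rewrite !mxE => ->; rewrite mul0r.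
rewrite {2}AE -row_mul !mulmxA mulmxV ?spectral_unit//.
by rewrite mul1mx row_mul row_diag_mx -scalemxAl -rowE.
Qed.

(** In the unitary coordinates [u = V v] the quadratic form becomes the sum of the [d_i |u_i|^2]. *)
Lemma spd_of_spectrum n (A : 'M[R]_n) : A^T = A ->
  (forall z, eigenvalue (cplx A) z -> 0 < z) -> spd A.
Proof.
move=> symA Apos; have [V [d [Vu deig AE]]] := symmetric_diag symA.
have d0 i : 0 < d 0 i by exact: Apos.
apply: spdI => // v v0; set x := (_ *m _ *m v) 0 0.
suff : 0 < x%:C%C :> R[i] by rewrite ltcR.
pose u := V *m cplx v.
have uT : (map_mx Num.conj u^T) = cplx v^T *m invmx V.
  rewrite trmx_mul map_mxM (invmx_unitary Vu); congr (_ *m _).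
  apply/matrixP => i j; rewrite !mxE; apply/CrealP/complex_realP.
  by exists (v j i).
have -> : x%:C%C = ((map_mx Num.conj u^T) *m diag_mx d *m u) 0 0.
  rewrite uT /u mulmxA -(mulmxA _ (invmx V)) -(mulmxA _ _ V) -AE.
  by rewrite -!map_mxM mxE.
rewrite mul_mx_diag mxE.
have u0 : u != 0.
  apply: contra_neq v0 => u0; apply: (@map_mx_inj _ _ (real_complex R)).
  by rewrite map_mx0 -(mulKmx (unitarymx_unit Vu) (cplx v)) -/u u0 mulmx0.
have /cV0Pn[i ui] := u0.
have dE j : (\matrix_(i, j) ((map_mx Num.conj u^T) i j * d 0 j)) 0 j * u j 0 =
    d 0 j * `|u j 0| ^+ 2.
  by rewrite !mxE normCK; ring.
rewrite (bigD1 i)//= dE ltr_wpDr//.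
  by apply: sumr_ge0 => j _; rewrite dE mulr_ge0 ?exprn_ge0// ltW.
by rewrite mulr_gt0// exprn_gt0 ?normr_gt0.
Qed.

(** Taking roots of the eigenvalues gives a complex root [S]. Its conjugate and its transpose are
    again roots of [A] with positive spectrum, so by uniqueness both equal [S]: it is real and
    symmetric. *)
Lemma spd_sqrt n (A : 'M[R]_n) : spd A -> exists2 Q, spd Q & Q *m Q = A.
Proof.
move=> sA; have [V [d [Vu deig AE]]] := symmetric_diag (spd_tr sA).
have d0 i : 0 < d 0 i by exact: spd_eigenvalue_gt0 (deig i).
pose s : 'rV[R[i]]_n := \row_i sqrtC (d 0 i).
have s0 i : 0 < s 0 i by rewrite mxE sqrtC_gt0.
have Vi := unitarymx_unit Vu.
pose S := invmx V *m diag_mx s *m V.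
have SS : S *m S = cplx A.
  have ss : diag_mx s *m diag_mx s = diag_mx d.
    rewrite mulmx_diag; congr diag_mx; apply/rowP => i.
    by rewrite [LHS]mxE !mxE -expr2 sqrtCK.
  by rewrite AE /S !mulmxA (mulmxK Vi) -(mulmxA (invmx V)) ss.
have Spos z : eigenvalue S z -> 0 < z.
  by move=> /(eigenvalue_conj_diag Vi)[i ->].
have sC : map_mx (@conjc R) s = s.
  apply/rowP => i; rewrite mxE.
  by have /CrealP := gtr0_real (s0 i).
have conjS : map_mx (@conjc R) S = S.
  apply: (@pos_sqrt_unique _ _ V s Vi _ s0).
  - move=> z; rewrite !map_mxM map_invmx map_diag_mx sC.
    by move=> /eigenvalue_conj_diag[|i ->//]; rewrite map_unitmx.
  - rewrite -/S SS -map_mxM SS; apply/matrixP => i j; rewrite !mxE.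
    by rewrite /= oppr0.
have trS : S^T = S.
  apply: (@pos_sqrt_unique _ _ V s Vi _ s0).
  - move=> z; rewrite !trmx_mul tr_diag_mx trmx_inv mulmxA.
    rewrite -{1}(invmxK V^T).
    by move=> /eigenvalue_conj_diag[|i ->//]; rewrite unitmx_inv unitmx_tr.
  - by rewrite -/S SS -trmx_mul SS map_trmx (spd_tr sA).
pose Q := map_mx (@complex.Re R) S.
have SE : S = cplx Q.
  apply/matrixP => i j; rewrite [RHS]mxE [Q i j]mxE.
  have /complex_realP[x ->] // : S i j \is Num.real.
  by apply/CrealP; move/matrixP : conjS => /(_ i j); rewrite mxE.
have QQ : Q *m Q = A.
  by apply: (@map_mx_inj _ _ (real_complex R)); rewrite map_mxM -SE.
exists Q => //; apply: spd_of_spectrum; last by rewrite -SE.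
by apply: (@map_mx_inj _ _ (real_complex R)); rewrite -map_trmx -SE.
Qed.

(** For [X = P^2] the equation reads [(P H P)^2 = P Z P], so [P H P] is taken to be the square root
    of [P Z P]. *)
Lemma riccati_spd n (X Z : 'M[R]_n) : spd X -> spd Z ->
  exists2 H, spd H & H *m X *m H = Z.
Proof.
move=> /spd_sqrt[P sP <-] sZ; have Pu := spd_unit sP.
have [Q sQ QQ] : exists2 Q, spd Q & Q *m Q = P *m Z *m P.
  by apply: spd_sqrt; rewrite -{1}(spd_tr sP); exact: spd_congr.
exists (invmx P *m Q *m invmx P).
  rewrite -{1}(spd_tr (spd_inv sP)); apply: spd_congr => //.
  by rewrite unitmx_inv.
rewrite !mulmxA mulmxKV// mulmxK// -(mulmxA (invmx P)) QQ.
by rewrite !mulmxA mulVmx// mul1mx mulmxK.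
Qed.

(** The matrix [X H] need not be symmetric, but for [X = P^2] it equals [P (P H P) P^-1]. It is
    therefore diagonalizable with the positive eigenvalues of [P H P], and [pos_sqrt_unique]
    applies. *)
Lemma principal_sqrt_mul_spd n (X H : 'M[R]_n) : spd X -> spd H ->
  principal_sqrt (X *m H *m X *m H) = X *m H.
Proof.
move=> /spd_sqrt[P sP <-] sH; have Pu := spd_unit sP.
have sK : spd (P *m H *m P) by rewrite -{1}(spd_tr sP); exact: spd_congr.
have [V [d [Vu deig KE]]] := symmetric_diag (spd_tr sK).
have d0 i : 0 < d 0 i by exact: spd_eigenvalue_gt0 (deig i).
pose W := V *m cplx (invmx P).
have Vi := unitarymx_unit Vu.
have Pi : cplx (invmx P) \in unitmx by rewrite map_unitmx unitmx_inv.
have Wu : W \in unitmx by rewrite unitmx_mul Vi.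
have XHE : cplx (P *m P *m H) = invmx W *m diag_mx d *m W.
  rewrite /W (invmx_mul Vi Pi).
  rewrite -map_invmx invmxK mulmxA -(mulmxA _ (invmx V)) -(mulmxA _ _ V) -KE.
  by rewrite -!map_mxM !mulmxA mulmxK.
set B := P *m P *m H *m (P *m P) *m H.
have sqrtXH : is_principal_sqrt B (P *m P *m H).
  split; first by rewrite /B !mulmxA.
  by move=> z; rewrite XHE => /(eigenvalue_conj_diag Wu)[i ->].
have Qu Q : is_principal_sqrt B Q -> cplx Q = invmx W *m diag_mx d *m W.
  move=> [QQ Qp]; apply: (@pos_sqrt_unique _ _ W d Wu _ d0 Qp).
  by rewrite -XHE -!map_mxM QQ /B !mulmxA.
apply: (@map_mx_inj _ _ (real_complex R)); rewrite XHE; apply: Qu.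
(* As [X H] is one principal root, [xget] returns a principal root and not the default [0]. *)
exact: (@xgetI _ 0 (is_principal_sqrt B) _ sqrtXH).
Qed.

End Spd.

(** * The Lyapunov operator *)

Section Lyapunov.
Variables (R : realType) (n : nat).
Implicit Types (X M L U A W : 'M[R]_n).

Lemma mxtraceB X M : \tr (X - M) = \tr X - \tr M.
Proof. exact: linearB. Qed.

Lemma mxtrace_quad W X :
  \tr (W *m X *m W^T) = \sum_i (row i W *m X *m (row i W)^T) 0 0.
Proof.
apply: eq_bigr => i _; rewrite -row_mul tr_row !mxE.
by apply: eq_bigr => j _; rewrite !mxE.
Qed.

(** For [M = S^2] the trace is that of [(S W) X (S W)^T], a sum of values of the quadratic form of
    [X] at the rows of [S W]. *)
Lemma mxtrace_congr_ge0 W X M : spd X -> spd M -> 0 <= \tr (W *m X *m W^T *m M).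
Proof.
move=> sX /spd_sqrt[S sS <-].
rewrite mulmxA mxtrace_mulC !mulmxA -{2}(spd_tr sS) -(mulmxA _ W^T) -trmx_mul.
by rewrite mxtrace_quad sumr_ge0// => i _; exact: quad_ge0.
Qed.

Lemma mxtrace_congr_eq0 W X M : spd X -> spd M ->
  \tr (W *m X *m W^T *m M) = 0 -> W = 0.
Proof.
move=> sX /spd_sqrt[S sS <-].
rewrite mulmxA mxtrace_mulC !mulmxA -{2}(spd_tr sS) -(mulmxA _ W^T) -trmx_mul.
rewrite mxtrace_quad => /eqP; rewrite psumr_eq0 => [|i _]; last exact: quad_ge0.
move=> /allP SW0.
suff SW : S *m W = 0 by rewrite -(mulKmx (spd_unit sS) W) SW mulmx0.
apply/row_matrixP => i; rewrite row0; apply/eqP/negPn/negP => r0.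
have /implyP/(_ isT)/eqP := SW0 i (mem_index_enum i).
by move=> e; have := quad_gt0 sX r0; rewrite e ltxx.
Qed.

(** Multiplying the equation by [L^T] and taking traces gives two nonnegative terms of sum zero; the
    vanishing of the first one forces [L = 0]. *)
Lemma lyapunov_eq0 X M L : spd X -> spd M -> X *m L *m M + M *m L *m X = 0 -> L = 0.
Proof.
move=> sX sM eq0; apply: trmx_inj; rewrite trmx0.
apply: (@mxtrace_congr_eq0 L^T X M sX sM); rewrite trmxK.
have : \tr (L^T *m X *m L *m M) + \tr (L^T *m M *m L *m X) = 0.
  by rewrite -linearD/= -!mulmxA -mulmxDr !mulmxA eq0 mulmx0 mxtrace0.
move=> /eqP; rewrite paddr_eq0; first by move=> /andP[/eqP].
  by have := mxtrace_congr_ge0 L^T sX sM; rewrite trmxK.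
by have := mxtrace_congr_ge0 L^T sM sX; rewrite trmxK.
Qed.

Lemma lyapunov_unique X M L U : spd X -> spd M ->
  X *m L *m M + M *m L *m X = U -> lyapunov X M U = L.
Proof.
move=> sX sM LU.
have := @xgetI _ 0 [set L | X *m L *m M + M *m L *m X = U]%classic L LU.
rewrite -/(lyapunov X M U) /= -{3}LU => /eqP; rewrite -subr_eq0 => /eqP eq0.
apply/eqP; rewrite -subr_eq0; apply/eqP/(lyapunov_eq0 sX sM).
rewrite !mulmxBr !mulmxBl -[RHS]eq0 opprD addrACA.
by rewrite -!addrA.
Qed.

(** The matrix of the Lyapunov operator on vectorized matrices. Its invertibility turns uniqueness
    into existence, and its inverse shows that the solution depends differentiably on [X]. *)
Definition lyapunov_mx X M : 'M[R]_(n * n) :=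
  lin_mulmx X *m lin_mulmxr M + lin_mulmx M *m lin_mulmxr X.

Lemma mul_mxvec_lyapunov X M L :
  mxvec L *m lyapunov_mx X M = mxvec (X *m L *m M + M *m L *m X).
Proof. by rewrite mulmxDr !mulmxA !mul_vec_lin/= linearD. Qed.

Lemma lyapunov_mx_unit X M : spd X -> spd M -> lyapunov_mx X M \in unitmx.
Proof.
move=> sX sM; rewrite -row_free_unit -kermx_eq0.
apply/negPn/negP => /rowV0Pn[v /sub_kermxP vA v0]; move/negP: v0; apply.
rewrite -(vec_mxK v) in vA *; move: vA; rewrite mul_mxvec_lyapunov => vA.
rewrite mxvec_eq0; apply/eqP/(lyapunov_eq0 sX sM)/eqP.
by rewrite -mxvec_eq0 vA.
Qed.

Lemma lyapunovE X M U : spd X -> spd M ->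
  lyapunov X M U = vec_mx (mxvec U *m invmx (lyapunov_mx X M)).
Proof.
move=> sX sM; apply: (lyapunov_unique sX sM).
apply: (can_inj (@mxvecK _ _ _)); rewrite -mul_mxvec_lyapunov vec_mxK.
by rewrite mulmxKV// lyapunov_mx_unit.
Qed.

Lemma lyapunovP X M U : spd X -> spd M ->
  X *m lyapunov X M U *m M + M *m lyapunov X M U *m X = U.
Proof.
move=> sX sM; rewrite lyapunovE//; apply: (can_inj (@mxvecK _ _ _)).
by rewrite -mul_mxvec_lyapunov vec_mxK mulmxKV// lyapunov_mx_unit.
Qed.

(** Transposition exchanges the two summands of the equation, so the transpose of the solution is a
    solution too. *)
Lemma lyapunov_tr X M U : spd X -> spd M -> U^T = U ->
  (lyapunov X M U)^T = lyapunov X M U.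
Proof.
move=> sX sM UT; apply/esym/(lyapunov_unique sX sM).
rewrite -[RHS]UT -[in RHS](lyapunovP U sX sM) linearD/= !trmx_mul.
by rewrite (spd_tr sX) (spd_tr sM) addrC !mulmxA.
Qed.

Lemma gbw_metricE X M L : spd X -> spd M ->
  gbw_metric M X (X *m L *m M + M *m L *m X) (X *m L *m M + M *m L *m X) =
  \tr (L *m X *m L *m M).
Proof.
move=> sX sM; rewrite /gbw_metric (lyapunov_unique sX sM erefl).
rewrite mulmxDr linearD/= !mulmxA.
have -> : \tr (L *m M *m L *m X) = \tr (L *m X *m L *m M).
  by rewrite -mulmxA mxtrace_mulC mulmxA.
by field.
Qed.

Lemma gbw_metric_ge0 X M U : spd X -> spd M -> U^T = U -> 0 <= gbw_metric M X U U.
Proof.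
move=> sX sM UT; rewrite -(lyapunovP U sX sM) gbw_metricE//.
by rewrite -[X in _ *m X *m M](lyapunov_tr sX sM UT) mxtrace_congr_ge0.
Qed.

(* Expand [0 <= tr ((L - m A) X (L - m A) M)] for [U = X L M + M L X]. *)
Lemma mxtrace_mul_gbw_le X M U A (m : R) : spd X -> spd M -> U^T = U -> A^T = A ->
  m * \tr (U *m A) <= gbw_metric M X U U + m ^+ 2 * \tr (A *m X *m A *m M).
Proof.
move=> sX sM UT AT; have LT := lyapunov_tr sX sM UT.
rewrite -(lyapunovP U sX sM) gbw_metricE//.
move: LT; set L := lyapunov X M U => LT.
have := mxtrace_congr_ge0 (L - m *: A) sX sM.
have -> : (L - m *: A)^T = L - m *: A by rewrite linearB/= linearZ/= LT AT.
rewrite !(mulmxBl, mulmxBr, =^~ scalemxAl, =^~ scalemxAr, scalerBr).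
rewrite !(mxtraceB, mxtraceZ) mulmxDl mxtraceD.
have -> : \tr (X *m L *m M *m A) = \tr (A *m X *m L *m M).
  by rewrite mxtrace_mulC !mulmxA.
have -> : \tr (M *m L *m X *m A) = \tr (L *m X *m A *m M).
  by rewrite -!mulmxA mxtrace_mulC !mulmxA.
lra.
Qed.
End Lyapunov.

(** * The transport from X to Y *)

Section Transport.
Variables (R : realType) (n : nat) (M X H : 'M[R]_n).
Hypotheses (sM : spd M) (sX : spd X) (sH : spd H).
Implicit Types t : R.

Local Notation N := (invmx M).
Local Notation E := (H - N).

(** For [M = 1] this interpolates between the identity and the optimal transport map [H] from a
    centred Gaussian of covariance [X] to one of covariance [H X H]. *)
Definition transport_mx t : 'M[R]_n := N + t *: E.
Local Notation G := transport_mx.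

(* A solution of the matrix Hamilton-Jacobi equation [A' = - A M A] *)
Definition transport_potential t : 'M[R]_n := N *m invmx (G t) *m E.
Local Notation A := transport_potential.

Definition transport_geodesic t : 'M[R]_n := M *m G t *m X *m G t *m M.

Let Mu : M \in unitmx. Proof. exact: spd_unit. Qed.

Lemma transport_mx_spd t : 0 <= t <= 1 -> spd (G t).
Proof.
move=> t01; have -> : G t = (1 - t) *: N + t *: H; last first.
  by apply: spd_segment => //; exact: spd_inv.
by rewrite /G scalerBr scalerBl scale1r -addrA [- _ + _]addrC.
Qed.

Lemma transport_mx0 : G 0 = N.
Proof. by rewrite /G scale0r addr0. Qed.

Lemma transport_mx1 : G 1 = H.
Proof. by rewrite /G scale1r addrC subrK. Qed.

Lemma transport_displacement_tr : E^T = E.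
Proof. by rewrite linearB/= (spd_tr sH) trmx_inv (spd_tr sM). Qed.

Lemma transport_mx_tr t : (G t)^T = G t.
Proof.
by rewrite /G linearD/= linearZ/= transport_displacement_tr trmx_inv (spd_tr sM).
Qed.

(** Substituting [G t - t E] for [M^-1] brings both sides to [E - t E (G t)^-1 E]. The two forms are
    transposes of each other, whence the symmetry of [A t]. *)
Lemma transport_potentialC t : G t \in unitmx -> A t = E *m invmx (G t) *m N.
Proof.
move=> Gu; have NE : N = G t - t *: E by rewrite /G addrK.
transitivity (E - t *: (E *m invmx (G t) *m E)).
  rewrite /A [X in X *m _ *m _ = _]NE mulmxBl mulmxV// mulmxBl mul1mx.
  by rewrite -!scalemxAl.
by rewrite [X in _ = _ *m X]NE [RHS]mulmxBr mulmxKV// -scalemxAr.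
Qed.

Lemma transport_potential_tr t : G t \in unitmx -> (A t)^T = A t.
Proof.
move=> Gu; rewrite [RHS]transport_potentialC// /A !trmx_mul trmx_inv.
by rewrite transport_mx_tr transport_displacement_tr trmx_inv (spd_tr sM) mulmxA.
Qed.

(** Since [A 0 = E], and the first trace is that of [M H X E], the difference is
    [tr ((M H - 1) X E)], where [M H - 1 = M E]. *)
Lemma transport_cost_potential :
  \tr (M *m H *m X *m H *m M *m A 1) - \tr (X *m A 0) = \tr (E *m X *m E *m M).
Proof.
rewrite /A transport_mx0 transport_mx1 invmxK mulVmx// mul1mx.
rewrite !mulmxA mulmxK// mulmxK ?spd_unit//.
have ME : M *m E = M *m H - 1%:M by rewrite mulmxBr mulmxV.
rewrite [RHS]mxtrace_mulC !mulmxA ME [(_ - _) *m X]mulmxBl [in RHS]mulmxBl mul1mx.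
by rewrite mxtraceB.
Qed.

Lemma transport_costE :
  \tr (E *m X *m E *m M) =
  \tr (N *m X) + \tr (N *m (M *m H *m X *m H *m M)) - 2 * \tr (X *m H).
Proof.
rewrite !(mulmxBl, mulmxBr) !mxtraceB.
rewrite !mulmxA mulVmx// mul1mx mulmxKV// mulmxKV// (mxtrace_mulC H X).
have -> : \tr (invmx M *m X *m H *m M) = \tr (X *m H).
  by rewrite mxtrace_mulC !mulmxA mulmxV// mul1mx.
lra.
Qed.

Lemma transport_geodesic_spd t : 0 <= t <= 1 -> spd (transport_geodesic t).
Proof.
move=> t01; have -> : transport_geodesic t = (G t *m M)^T *m X *m (G t *m M).
  by rewrite trmx_mul transport_mx_tr (spd_tr sM) !mulmxA.
apply: spd_congr => //; rewrite unitmx_mul Mu andbT.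
exact/spd_unit/transport_mx_spd.
Qed.

Lemma transport_geodesic0 : transport_geodesic 0 = X.
Proof.
by rewrite /transport_geodesic transport_mx0 mulmxV// mul1mx mulmxKV.
Qed.

Lemma transport_geodesic1 : transport_geodesic 1 = M *m H *m X *m H *m M.
Proof. by rewrite /transport_geodesic transport_mx1. Qed.

(** The identities [A M G = E = G M A] show that [A t] solves the Lyapunov equation with right-hand
    side [U]; they also remove [t] from the resulting trace. *)
Lemma gbw_metric_transport_geodesic t : 0 <= t <= 1 ->
  let U := M *m E *m X *m G t *m M + M *m G t *m X *m E *m M in
  gbw_metric M (transport_geodesic t) U U = \tr (E *m X *m E *m M).
Proof.
move=> t01 /=; have Gu := spd_unit (transport_mx_spd t01).
have AMG : A t *m M *m G t = E by rewrite transport_potentialC// mulmxKV// mulmxKV.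
have GMA : G t *m M *m A t = E by rewrite /A !mulmxA mulmxK// mulmxV// mul1mx.
have h1 : M *m A t *m transport_geodesic t = M *m E *m X *m G t *m M.
  by rewrite /transport_geodesic -AMG !mulmxA.
have h2 : transport_geodesic t *m A t *m M = M *m G t *m X *m E *m M.
  by rewrite /transport_geodesic -GMA !mulmxA.
rewrite -h1 -h2 addrC gbw_metricE//; last exact: transport_geodesic_spd.
by rewrite /transport_geodesic !mulmxA AMG mulmxK// (mulmxK Gu).
Qed.
End Transport.

(** * Matrix calculus along curves *)

Local Open Scope classical_set_scope.

Section MatrixCalculus.
Variables (R : realType).
Implicit Types t : R.

Lemma derivable_bigsum (I : Type) (r : seq I) (h : I -> R -> R) t :
  (forall i, derivable (h i) t 1) -> derivable (fun x => \sum_(i <- r) h i x) t 1.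
Proof.
move=> dh; elim: r => [|i r IH].
  by under eq_fun do rewrite big_nil; exact: derivable_cst.
by under eq_fun do rewrite big_cons; exact: derivableD.
Qed.

Lemma derivable_bigprod (I : Type) (r : seq I) (h : I -> R -> R) t :
  (forall i, derivable (h i) t 1) -> derivable (fun x => \prod_(i <- r) h i x) t 1.
Proof.
move=> dh; elim: r => [|i r IH].
  by under eq_fun do rewrite big_nil; exact: derivable_cst.
by under eq_fun do rewrite big_cons; exact: derivableM.
Qed.

Lemma is_derive_bigsum (I : Type) (r : seq I) (h : I -> R -> R) (dh : I -> R) t :
  (forall i, is_derive t 1 (h i) (dh i)) ->
  is_derive t 1 (fun x => \sum_(i <- r) h i x) (\sum_(i <- r) dh i).
Proof.
move=> dhP; elim: r => [|i r IH].
  by rewrite big_nil; under eq_fun do rewrite big_nil; exact: is_derive_cst.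
by rewrite big_cons; under eq_fun do rewrite big_cons; exact: is_deriveD.
Qed.

Lemma is_derive_mxP m n (F : R -> 'M[R]_(m, n)) (dF : 'M[R]_(m, n)) t :
  is_derive t 1 F dF <-> forall i j, is_derive t 1 (fun x => F x i j) (dF i j).
Proof.
split=> [[F1 F2] i j|FdF].
  apply: DeriveDef; first exact: (derivable_mxP _ _ _).1.
  by rewrite -F2 derive_mx// mxE.
have dF' : derivable F t 1 by apply/derivable_mxP => i j; have [] := FdF i j.
apply: DeriveDef => //; rewrite derive_mx//; apply/matrixP => i j.
by rewrite mxE; have [] := FdF i j.
Qed.

Lemma is_derive_mulmx m n p (F : R -> 'M[R]_(m, n)) (G : R -> 'M[R]_(n, p))
    dF dG t :
  is_derive t 1 F dF -> is_derive t 1 G dG ->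
  is_derive t 1 (fun x => F x *m G x) (F t *m dG + dF *m G t).
Proof.
move=> /is_derive_mxP F' /is_derive_mxP G'; apply/is_derive_mxP => i j.
under eq_fun do rewrite mxE.
rewrite !mxE -big_split/=; apply: is_derive_bigsum => k.
apply: (is_derive_eq (is_deriveM (F' i k) (G' k j))).
by congr (_ + _); rewrite [RHS]mulrC.
Qed.

Lemma is_derive_mxtrace n (F : R -> 'M[R]_n) dF t :
  is_derive t 1 F dF -> is_derive t 1 (fun x => \tr (F x)) (\tr dF).
Proof. by move=> /is_derive_mxP F'; exact: is_derive_bigsum. Qed.

Lemma is_derive_scalemx m n (s : R -> R) (ds : R) (B : 'M[R]_(m, n)) t :
  is_derive t 1 s ds -> is_derive t 1 (fun x => s x *: B) (ds *: B).
Proof.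
move=> s'; apply/is_derive_mxP => i j; rewrite mxE.
under eq_fun do rewrite mxE.
apply: (is_derive_eq (is_deriveM s' (is_derive_cst (B i j) _ _))).
by rewrite scaler0 add0r; exact: mulrC.
Qed.

Lemma is_derive_linear_mx m n p q (phi : {linear 'M[R]_(m, n) -> 'M[R]_(p, q)})
    (F : R -> 'M[R]_(m, n)) dF t :
  is_derive t 1 F dF -> is_derive t 1 (fun x => phi (F x)) (phi dF).
Proof.
move=> /is_derive_mxP F'; apply/is_derive_mxP => k l.
have phiE A : phi A k l = \sum_i \sum_j A i j * phi (delta_mx i j) k l.
  rewrite {1}(matrix_sum_delta A) linear_sum summxE; apply: eq_bigr => i _.
  by rewrite linear_sum summxE; apply: eq_bigr => j _; rewrite linearZ mxE.
rewrite phiE; under eq_fun do rewrite phiE.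
apply: is_derive_bigsum => i; apply: is_derive_bigsum => j.
apply: (is_derive_eq (is_deriveM (F' i j)
  (is_derive_cst (phi (delta_mx i j) k l) _ _))).
by rewrite scaler0 add0r; exact: mulrC.
Qed.

Lemma derivable_det n (F : R -> 'M[R]_n) t :
  derivable F t 1 -> derivable (fun x => \det (F x)) t 1.
Proof.
move=> /derivable_mxP dF; apply: derivable_bigsum => s.
by apply: derivableM => //; exact: derivable_bigprod.
Qed.

Lemma derivable_adj n (F : R -> 'M[R]_n) t :
  derivable F t 1 -> derivable (fun x => \adj (F x)) t 1.
Proof.
move=> /derivable_mxP dF; apply/derivable_mxP => i j.
under eq_fun do rewrite mxE; apply: derivableM => //; apply: derivable_det.
apply/derivable_mxP => k l; under eq_fun do rewrite !mxE; exact: dF.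
Qed.

Lemma near_unitmx n (F : R -> 'M[R]_n) t : derivable F t 1 -> F t \in unitmx ->
  \forall x \near t, F x \in unitmx.
Proof.
move=> /derivable_det/derivable1_diffP/differentiable_continuous dc.
rewrite unitmxE unitfE => dt0.
near=> x; rewrite unitmxE unitfE; near: x.
exact: (cvgr_neq0 _ dc dt0).
Unshelve. all: by end_near. Qed.

(** Near [t] the matrix stays invertible, so Cramer's formula expresses its inverse by the
    determinant and the adjugate. *)
Lemma derivable_invmx n (F : R -> 'M[R]_n) t : derivable F t 1 -> F t \in unitmx ->
  derivable (fun x => invmx (F x)) t 1.
Proof.
move=> dF Fu.
apply: (@near_eq_derivable _ _ _ (fun x => (\det (F x))^-1 *: \adj (F x))).
  have := near_unitmx dF Fu; apply: filterS => x Fx.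
  by rewrite /invmx Fx.
apply/derivable_mxP => i j; under eq_fun do rewrite mxE.
apply: derivableM; last exact: (derivable_mxP _ _ _).1 (derivable_adj dF) i j.
by apply: derivableV; [rewrite -unitfE -unitmxE|exact: derivable_det].
Qed.

(** Differentiate [F F^-1 = 1], an identity valid in a neighbourhood of [t]. *)
Lemma is_derive_invmx n (F : R -> 'M[R]_n) dF t : is_derive t 1 F dF ->
  F t \in unitmx ->
  is_derive t 1 (fun x => invmx (F x)) (- (invmx (F t) *m dF *m invmx (F t))).
Proof.
move=> F' Fu; have dF' : derivable F t 1 by [].
have /derivableP W' := derivable_invmx dF' Fu.
apply: (is_derive_eq W').
set W := (X in X = _) in W' *.
have : is_derive t 1 (fun x => F x *m invmx (F x)) 0.
  apply: (@near_eq_is_derive _ _ _ (cst 1%:M)).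
    have := near_unitmx dF' Fu; apply: filterS => x Fx.
    by rewrite mulmxV.
move=> [_]; have [_ ->] := is_derive_mulmx F' W' => /eqP.
rewrite addr_eq0 => /eqP FW.
by rewrite -(mulKmx Fu W) FW mulmxN mulmxA.
Qed.

End MatrixCalculus.

(** * Primitives on a closed interval *)

Section Primitive.
Variables (R : realType).
Local Notation mu := (@lebesgue_measure R).

Let clamp (a b t : R) := Num.max a (Num.min t b).

(* The integrand is extended by constants outside [a, b], so that the
   fundamental theorem of calculus also applies at the endpoints. *)
Lemma exists_primitive (f : R -> R) (a b : R) : a < b ->
  (forall t, a <= t <= b -> {for t, continuous f}) ->
  exists2 F : R -> R, (forall t, a <= t <= b -> is_derive t 1 F (f t)) &
    (\int[mu]_(t in `[a, b]) (f t)%:E = (F b - F a)%:E)%E.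
Proof.
move=> ab cf; pose g t := f (clamp a b t).
have clamp_in t : a <= clamp a b t <= b.
  by rewrite /clamp le_max lexx/= ge_max (ltW ab)/= ge_min lexx orbT.
have clampE t : a <= t <= b -> clamp a b t = t.
  by move=> /andP[at_ tb]; rewrite /clamp (min_idPl tb) (max_idPr at_).
have cg : continuous g.
  move=> t; apply: continuous_comp; last exact/cf/clamp_in.
  apply: continuous_max; first exact: cst_continuous.
  by apply: continuous_min => //; exact: cst_continuous.
have ig u : mu.-integrable `[a - 1, u] (EFin \o g).
  apply: continuous_compact_integrable; first exact: segment_compact.
  exact: continuous_subspaceT.
(* Starting the integral at [a - 1] makes [a] an interior point; [t + 1] below plays the same role
   on the right. *)
pose F x := (\int[mu]_(t in `[(a - 1)%R, x]) g t)%R.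
have dF t : a <= t <= b -> is_derive t 1 F (f t).
  move=> tab; have /andP[at_ tb] := tab.
  have t1 : a - 1 < t by rewrite (lt_le_trans _ at_)// ltrBlDr ltrDl.
  have tt1 : t < t + 1 by rewrite ltrDl.
  have [dF Fg] :=
    @continuous_FTC1_closed _ g (a - 1) t (t + 1) tt1 (ig _) t1 (cg t).
  by apply: DeriveDef => //; rewrite -derive1E Fg /g clampE.
exists F => //.
have FC t : a <= t <= b -> {for t, continuous F}.
  by move=> /dF[dFt _]; exact/differentiable_continuous/derivable1_diffP.
rewrite (@continuous_FTC2 _ f F)//.
- apply/continuous_in_subspaceT => t; rewrite inE/= in_itv/= => tab.
  exact: cf.
- split.
  + move=> t; rewrite in_itv/= => /andP[/ltW at_ /ltW tb].
    by have [] : is_derive t 1 F (f t) by apply: dF; rewrite at_.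
  + by apply: cvg_at_right_filter; apply: FC; rewrite lexx ltW.
  + by apply: cvg_at_left_filter; apply: FC; rewrite lexx ltW.
- move=> t; rewrite in_itv/= => /andP[/ltW ? /ltW ?].
  by rewrite derive1E; apply: derive_val; apply: dF; apply/andP.
Qed.

End Primitive.

(** * Speed of a curve and the Hamilton-Jacobi estimate on a smooth piece *)

Section Speed.
Variables (R : realType) (n : nat).
Implicit Types (M X H : 'M[R]_n) (f : R -> 'M[R]_n) (t : R).

(* [lyapunov] is only an explicit function of the curve where the curve is
   positive definite; this formula makes sense in a neighbourhood. *)
Definition gbw_speed M f t : R := Num.sqrt
  (2^-1 * \tr (vec_mx (mxvec (derive1 f t) *m invmx (lyapunov_mx (f t) M))
    *m derive1 f t)).

Lemma gbw_speedE M f t : spd M -> spd (f t) ->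
  gbw_speed M f t = Num.sqrt (gbw_metric M (f t) ('D_1 f t) ('D_1 f t)).
Proof. by move=> sM sf; rewrite /gbw_speed derive1E /gbw_metric lyapunovE. Qed.

(** The radicand is differentiable, because the Lyapunov matrix is invertible at [t]. The square
    root only preserves continuity, as the speed may vanish. *)
Lemma continuous_gbw_speed M f t : spd M ->
  derivable f t 1 -> derivable (derive1 f) t 1 -> spd (f t) ->
  {for t, continuous (gbw_speed M f)}.
Proof.
move=> sM /derivableP df /derivableP ddf sf.
apply: continuous_comp; last exact: sqrt_continuous.
apply/differentiable_continuous/derivable1_diffP; apply: derivableM => //.
have dl : is_derive t 1 (fun x => lyapunov_mx (f x) M)
    (lyapunov_mx ('D_1 f t) M).
  apply: (is_derive_eq (is_deriveD
    (is_derive_mulmx (is_derive_linear_mx lin_mulmx df)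
                     (is_derive_cst (lin_mulmxr M) _ _))
    (is_derive_mulmx (is_derive_cst (lin_mulmx M) _ _)
                     (is_derive_linear_mx lin_mulmxr df)))).
  by rewrite mulmx0 mul0mx add0r addr0.
have li := is_derive_invmx dl (lyapunov_mx_unit sf sM).
have := is_derive_mxtrace (is_derive_mulmx (is_derive_linear_mx vec_mx
  (is_derive_mulmx (is_derive_linear_mx mxvec ddf) li)) ddf).
by case.
Qed.

(** The Hamilton-Jacobi equation combined with the chain rule: only the factor [G^-1] of
    [M^-1 G^-1 E] varies, and [M M^-1] is inserted to recognize [A M A]. *)
Lemma is_derive_transport_potential M H (s : R -> R) ds t :
  transport_mx M H (s t) \in unitmx -> M \in unitmx -> is_derive t 1 s ds ->
  let A := transport_potential M H in
  is_derive t 1 (fun x => A (s x)) (- (ds *: (A (s t) *m M *m A (s t)))).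
Proof.
move=> Gu Mu s' /=.
have G' : is_derive t 1 (fun x => transport_mx M H (s x)) (ds *: (H - invmx M)).
  apply: (is_derive_eq (is_deriveD (is_derive_cst (invmx M) _ _)
    (is_derive_scalemx (H - invmx M) s'))).
  by rewrite add0r.
apply: (is_derive_eq (is_derive_mulmx (is_derive_mulmx (is_derive_cst (invmx M) _ _)
  (is_derive_invmx G' Gu)) (is_derive_cst (H - invmx M) _ _))).
rewrite mulmx0 add0r mul0mx addr0 mulmxN mulNmx.
rewrite -scalemxAr -!scalemxAl -scalemxAr -scalemxAl.
by rewrite /transport_potential !mulmxA (mulmxK Mu).
Qed.

Lemma derive1_symmetric f t : derivable f t 1 ->
  (\forall x \near t, (f x)^T = f x) ->
  (derive1 f t)^T = derive1 f t.
Proof.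
move=> /derivableP df fT; rewrite derive1E.
have [_ <-] := is_derive_linear_mx trmx df.
by apply: near_eq_derive; apply: filterS fT.
Qed.

(** Here [L] is a primitive of the speed and [sg] is the age of the potential along the curve. The
    claim says that [h], the trace minus [K L], does not increase from [a] to [b]. *)
Lemma transport_potential_smooth_le M H f (L : R -> R) (a b e K s0 : R) :
  let A := transport_potential M H in
  let s := s0 + K^-1 * (L b - L a + e * (b - a)) in
  spd M -> spd H -> a < b ->
  (forall t, a <= t <= b -> [/\ derivable f t 1, spd (f t) &
     is_derive t 1 L (gbw_speed M f t)]) ->
  0 < e -> 0 < K -> 0 <= s0 -> s <= 1 ->
  \tr (f b *m A s) - \tr (f a *m A s0) <= K * (L b - L a).
Proof.
move=> A s sM sH ab fL e0 K0 s00 s1.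
pose sg t := s0 + K^-1 * (L t - L a + e * (t - a)).
have L' t : a <= t <= b -> is_derive t 1 L (gbw_speed M f t) by case/fL.
have sg' t : a <= t <= b -> is_derive t 1 sg (K^-1 * (gbw_speed M f t + e)).
  move=> /L' Lt.
  apply: (is_derive_eq (is_deriveD (is_derive_cst s0 _ _) (is_deriveZ K^-1
     (is_deriveD (is_deriveB Lt (is_derive_cst (L a) _ _))
        (is_deriveZ e (is_deriveB (is_derive_id t 1) (is_derive_cst a _ _))))))).
  by rewrite add0r !subr0 /GRing.scale/= mulr1.
have sgcont t : a <= t <= b -> {for t, continuous sg}.
  by move=> /sg'[d _]; exact/differentiable_continuous/derivable1_diffP.
have oo_cc t : t \in `]a, b[%R -> a <= t <= b.
  by rewrite in_itv/= => /andP[/ltW-> /ltW->].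
(* Monotonicity keeps [sg] between [s0] and [s], hence in [0, 1], where [G] is positive definite and
   thus invertible. *)
have sg_mono : {in `[a, b]%R &, {homo sg : x y / x <= y >-> x <= y}}.
  apply: ger0_derive1_le_cc.
  - by move=> t /oo_cc/sg'[].
  - move=> t /oo_cc/sg'[_]; rewrite derive1E => ->.
    by rewrite mulr_ge0 ?invr_ge0 ?(ltW K0)// addr_ge0 ?sqrtr_ge0// ltW.
  - by apply/continuous_in_subspaceT => t; rewrite inE/= in_itv/=; exact: sgcont.
have sga : sg a = s0 by rewrite /sg !subrr mulr0 addr0 mulr0 addr0.
have sg01 t : a <= t <= b -> 0 <= sg t <= 1.
  move=> /andP[at_ tb]; apply/andP; split.
    by rewrite (le_trans s00)// -sga sg_mono// in_itv/= ?lexx ?(ltW ab)// at_.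
  by rewrite (le_trans _ s1)// sg_mono// in_itv/= ?lexx ?(ltW ab)// at_.
pose h t := \tr (f t *m A (sg t)) - K * L t.
pose dh t := \tr (f t *m - ((K^-1 * (gbw_speed M f t + e)) *:
     (A (sg t) *m M *m A (sg t))) + derive1 f t *m A (sg t)) - K * gbw_speed M f t.
have Gu t : a <= t <= b -> transport_mx M H (sg t) \in unitmx.
  by move=> /sg01 ?; exact/spd_unit/transport_mx_spd.
have h' t : a <= t <= b -> is_derive t 1 h (dh t).
  move=> tab; have [/derivableP df _ _] := fL _ tab.
  have A' := is_derive_transport_potential (Gu _ tab) (spd_unit sM) (sg' _ tab).
  have := is_deriveB (is_derive_mxtrace (is_derive_mulmx df A'))
    (is_deriveZ K (L' _ tab)).
  by rewrite /dh derive1E.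
have : h b <= h a.
  apply: (@ler0_derive1_le_cc _ h a b).
  - by move=> t /oo_cc/h'[].
  - move=> t tab; have tcc := oo_cc _ tab.
    have [_] := h' _ tcc; rewrite derive1E => ->.
    have [df sf _] := fL _ tcc.
    have fT : (derive1 f t)^T = derive1 f t.
      apply: derive1_symmetric => //.
      have := near_in_itvoo tab; apply: filterS => x /oo_cc xab.
      by have [_ /spd_tr] := fL _ xab.
    have AT : (A (sg t))^T = A (sg t).
      by apply: transport_potential_tr => //; exact: Gu.
    set l := gbw_speed M f t; set m := K^-1 * (l + e).
    have l0 : 0 <= l by exact: sqrtr_ge0.
    have m0 : 0 < m by rewrite mulr_gt0 ?invr_gt0// ltr_wpDl.
    have g2 : gbw_metric M (f t) (derive1 f t) (derive1 f t) = l ^+ 2.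
      by rewrite /l gbw_speedE// -derive1E sqr_sqrtr// gbw_metric_ge0.
    have := mxtrace_mul_gbw_le m sf sM fT AT; rewrite g2.
    rewrite /dh -/l -/m linearD/= mulmxN -scalemxAr linearN/= linearZ/=.
    have trC (P Q : 'M[R]_n) : \tr (P *m (Q *m M *m Q)) = \tr (Q *m P *m Q *m M).
      by rewrite !mulmxA mxtrace_mulC !mulmxA.
    rewrite trC.
    move: (\tr _) (\tr _) => x y xy.
    (* As [e > 0], the rate [m] is positive even where the speed vanishes. After multiplication by
       [m], the trace inequality bounds [m dh] by [l^2 - m K l = - e l]. *)
    rewrite -(pmulr_rle0 _ m0).
    have Km : K * m = l + e by rewrite /m mulrA divff ?mul1r// gt_eqF.
    have : l ^+ 2 <= (K * m) * l by rewrite Km mulrDl lerDl mulr_ge0// ltW.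
    nra.
  - apply/continuous_in_subspaceT => t; rewrite inE/= in_itv/= => /h'[d _].
    exact/differentiable_continuous/derivable1_diffP.
  - by rewrite in_itv/= lexx ltW.
  - by rewrite in_itv/= lexx ltW.
  - exact: ltW.
rewrite /h sga /sg -/s; lra.
Qed.

End Speed.

(** * The lower bound *)

(** A curve and its smooth extension off a segment share their derivative only in the interior; the
    endpoints do not affect measurability or the integral. *)
Lemma eq_oo_integral_itvcc (R : realType) (f g : R -> R) (a b : R) :
  {in `]a, b[%classic, f =1 g} -> measurable_fun `[a, b] f ->
  measurable_fun `[a, b] g /\
  (\int[@lebesgue_measure R]_(t in `[a, b]) (g t)%:E =
   \int[@lebesgue_measure R]_(t in `[a, b]) (f t)%:E)%E.
Proof.
move=> fg mf.
have mfo : measurable_fun `]a, b[ f.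
  by apply: measurable_funS mf => //; exact: subset_itv_oo_cc.
have mgo : measurable_fun `]a, b[ g by exact: eq_measurable_fun mfo.
split; first by apply: measurable_fun_itv_cc mgo.
rewrite integral_itv_bndoo; last exact/measurable_EFinP.
rewrite [RHS]integral_itv_bndoo; last exact/measurable_EFinP.
by apply: eq_integral => t tab; rewrite -fg.
Qed.

Section LowerBound.
Variables (R : realType) (n : nat) (M H : 'M[R]_n).
Hypotheses (sM : spd M) (sH : spd H).
Implicit Types (c : R -> 'M[R]_n) (t : R).
Local Notation mu := (@lebesgue_measure R).
Local Notation A := (transport_potential M H).
Local Notation speed c :=
  (fun t => Num.sqrt (gbw_metric M (c t) ('D_1 c t) ('D_1 c t))).

(* [l] is the length of [c] on [a, b]; the potential ages by [K^-1 (l + e (b - a))]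
   along [c], the term [e] making the ageing rate positive. *)
Definition transport_length_bound c (a b l : R) : Prop :=
  [/\ measurable_fun `[a, b] (speed c),
      (\int[mu]_(t in `[a, b]) (speed c t)%:E = l%:E)%E &
      forall e K s0, 0 < e -> 0 < K -> 0 <= s0 ->
        let s := s0 + K^-1 * (l + e * (b - a)) in s <= 1 ->
        \tr (c b *m A s) - \tr (c a *m A s0) <= K * l].

(** Everything is computed for the smooth extension [f], whose speed is continuous up to the
    endpoints; the length is the increment of a primitive of that speed. *)
Lemma transport_length_bound_smooth c a b : a < b -> smooth_on_segment a b c ->
  (forall t, a <= t <= b -> spd (c t)) -> exists l, transport_length_bound c a b l.
Proof.
move=> ab [U [f [oU abU fc fsmooth]]] sc.
have fcE t : a <= t <= b -> f t = c t by move=> tab; apply: fc; rewrite in_itv.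
have Ut t : a <= t <= b -> U t by move=> tab; apply: abU; rewrite /= in_itv.
have fd t : a <= t <= b ->
    [/\ derivable f t 1, derivable (derive1 f) t 1 & spd (f t)].
  move=> tab; split; last by rewrite fcE//; exact: sc.
    exact: (fsmooth 0 _ (Ut _ tab)).
  exact: (fsmooth 1 _ (Ut _ tab)).
have oo_cc t : t \in `]a, b[%R -> a <= t <= b.
  by rewrite in_itv/= => /andP[/ltW-> /ltW->].
have cs t : a <= t <= b -> {for t, continuous (gbw_speed M f)}.
  by move=> /fd[d1 d2 sf]; exact: continuous_gbw_speed.
have [L L' intL] := exists_primitive ab cs.
have speedE : {in `]a, b[%classic, gbw_speed M f =1 speed c}.
  move=> t; rewrite inE/= => tab; have [d1 d2 sf] := fd _ (oo_cc _ tab).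
  have DE : 'D_1 f t = 'D_1 c t.
    apply: near_eq_derive; have := near_in_itvoo tab; apply: filterS => x /oo_cc.
    exact: fcE.
  by rewrite (gbw_speedE sM sf) DE (fcE _ (oo_cc _ tab)).
have mf : measurable_fun `[a, b] (gbw_speed M f).
  apply: subspace_continuous_measurable_fun => //.
  apply/continuous_in_subspaceT => t; rewrite inE/= in_itv/=; exact: cs.
have [mc ic] := eq_oo_integral_itvcc speedE mf.
exists (L b - L a); split; [exact: mc|by rewrite -intL; exact: ic|].
move=> e K s0 e0 K0 s00 /= s1.
  have aab : a <= a <= b by rewrite lexx ltW.
  have bab : a <= b <= b by rewrite lexx ltW.
  rewrite -(fcE _ aab) -(fcE _ bab).
  apply: (transport_potential_smooth_le sM sH ab _ e0 K0 s00 s1) => t tab.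
  by have [d1 _ sf] := fd _ tab; split; [exact: d1|exact: sf|exact: L'].
Qed.

Lemma transport_length_bound_cat c a x b l m : a <= x -> x <= b ->
  transport_length_bound c a x l -> transport_length_bound c x b m ->
  transport_length_bound c a b (l + m).
Proof.
move=> ax xb [m1 i1 b1] [m2 i2 b2].
have m2' : measurable_fun `]x, b] (speed c).
  by apply: measurable_funS m2 => //; apply: subset_itvr; rewrite bnd_simp.
have abU : `[a, b]%classic = `[a, x] `|` `]x, b] :> set R.
  by rewrite -itv_bndbnd_setU// bnd_simp.
have l0 : 0 <= l.
  by rewrite -lee_fin -i1; apply: integral_ge0 => t _; rewrite lee_fin sqrtr_ge0.
have m0 : 0 <= m.
  by rewrite -lee_fin -i2; apply: integral_ge0 => t _; rewrite lee_fin sqrtr_ge0.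
have mU : measurable_fun `[a, b] (speed c).
  by rewrite abU; apply/measurable_funU.
split => //.
- rewrite abU integral_setU//=.
  + rewrite i1 integral_itv_obnd_cbnd ?i2//.
    exact/measurable_EFinP.
  + by apply/measurable_EFinP; rewrite -abU.
  + apply/disj_set2P; apply/seteqP; split => // t [] /=.
    by rewrite !in_itv/= => /andP[_ tx] /andP[/lt_le_trans/(_ tx)]; rewrite ltxx.
- move=> e K s0 e0 K0 s00 /= s1.
  (* The age reached at [x] is the starting age on the second piece; it is at most 1 because that
     piece only adds to it. *)
  pose s' := s0 + K^-1 * (l + e * (x - a)).
  have sE : s0 + K^-1 * (l + m + e * (b - a)) = s' + K^-1 * (m + e * (b - x)).
    by rewrite /s'; ring.
  have Ki : 0 < K^-1 by rewrite invr_gt0.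
  have s'0 : 0 <= s'.
    rewrite addr_ge0// mulr_ge0 ?(ltW Ki)// addr_ge0// mulr_ge0 ?(ltW e0)//.
    by rewrite subr_ge0.
  have s'1 : s' <= 1.
    rewrite (le_trans _ s1)// sE lerDl mulr_ge0 ?(ltW Ki)// addr_ge0//.
    by rewrite mulr_ge0 ?(ltW e0)// subr_ge0.
  have h1 := b1 e K s0 e0 K0 s00 s'1.
  rewrite sE in s1 *.
  have h2 := b2 e K s' e0 K0 s'0 s1.
  have := lerD h2 h1; rewrite -/s' subrKA => /le_trans; apply.
  by rewrite mulrDr addrC.
Qed.

Lemma transport_length_bound_partition c a b (s : seq R) : itv_partition a b s ->
  (forall i : nat, (i < size s)%N ->
      smooth_on_segment (nth 0 (a :: s) i) (nth 0 (a :: s) i.+1) c) ->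
  (forall t, a <= t <= b -> spd (c t)) ->
  exists l, transport_length_bound c a b l.
Proof.
elim: s a => [a /itv_partition_nil<- _ _|x s IH a abs smooth_c sc].
  exists 0; split.
  - by rewrite set_itv1; exact: measurable_fun_set1.
  - by rewrite set_itv1 integral_set1.
  - by move=> e K s0 _ _ _ /= _; rewrite subrr !(mulr0, addr0) subrr.
have xb := itv_partition_le (itv_partition_cons abs).
have ax : a < x by case: abs => /= /andP[].
have [l lP] : exists l, transport_length_bound c a x l.
  apply: transport_length_bound_smooth => //; first exact: (smooth_c 0).
  by move=> t /andP[at_ tx]; apply: sc; rewrite at_; exact: le_trans tx xb.
have [m mP] : exists m, transport_length_bound c x b m.
  apply: IH (itv_partition_cons abs) _ _ => [i is_|t /andP[xt tb]].
    exact: (smooth_c i.+1).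
  by apply: sc; rewrite tb andbT; exact: le_trans (ltW ax) xt.
by exists (l + m); exact: (transport_length_bound_cat (ltW ax) xb lP mP).
Qed.

End LowerBound.

(** * The geodesic *)

Section Geodesic.
Variables (R : realType) (n : nat).
Implicit Types (A B C M X H : 'M[R]_n) (t : R).
Local Notation mu := (@lebesgue_measure R).

(** The geodesic has degree two in [t]. This family is closed under differentiation, so all iterated
    derivatives exist. *)
Definition quadratic_curve A B C t : 'M[R]_n := A + t *: B + t ^+ 2 *: C.

Lemma is_derive_quadratic_curve A B C t :
  is_derive t 1 (quadratic_curve A B C) (quadratic_curve B (2 *: C) 0 t).
Proof.
have t2 : is_derive t 1 (fun x : R => x ^+ 2) (2 * t).
  under eq_fun do rewrite expr2.
  apply: (is_derive_eq (is_deriveM (is_derive_id t 1) (is_derive_id t 1))).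
  by rewrite /GRing.scale/= mulr1; ring.
apply: (is_derive_eq (is_deriveD (is_deriveD (is_derive_cst A _ _)
  (is_derive_scalemx B (is_derive_id t 1))) (is_derive_scalemx C t2))).
by rewrite /quadratic_curve scaler0 addr0 add0r scale1r scalerA mulrC.
Qed.

Lemma derivable_derive1n_quadratic_curve A B C k t :
  derivable (derive1n k (quadratic_curve A B C)) t 1.
Proof.
have [A' [B' [C' ->]]] : exists A' B' C',
    derive1n k (quadratic_curve A B C) = quadratic_curve A' B' C'.
  elim: k => [|k [A' [B' [C' IH]]]]; first by exists A, B, C.
  exists B', (2 *: C'), 0; rewrite derive1nS IH; apply/funext => x.
  by rewrite derive1E; have [_ ->] := is_derive_quadratic_curve A' B' C' x.
by have [] := is_derive_quadratic_curve A' B' C' t.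
Qed.

Lemma transport_geodesic_quadratic M X H : let E := H - invmx M in
  transport_geodesic M X H = quadratic_curve
    (M *m invmx M *m X *m invmx M *m M)
    (M *m E *m X *m invmx M *m M + M *m invmx M *m X *m E *m M)
    (M *m E *m X *m E *m M).
Proof.
move=> E; apply/funext => t.
rewrite /transport_geodesic /quadratic_curve /transport_mx -/E.
move: (invmx M) (E) => N F.
rewrite !(mulmxDr, mulmxDl) -!(scalemxAr, scalemxAl) scalerA scalerDr.
by rewrite -!addrA; congr (_ + _); rewrite addrCA.
Qed.

Lemma transport_geodesic_smooth M X H : piecewise_smooth (transport_geodesic M X H).
Proof.
exists [:: 1]; first exact: itv_partition1.
move=> [|//] _; exists setT, (transport_geodesic M X H); split => //.
  exact: openT.
move=> k t _; rewrite transport_geodesic_quadratic.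
exact: derivable_derive1n_quadratic_curve.
Qed.

Lemma is_derive_transport_geodesic M X H t : let E := H - invmx M in
  is_derive t 1 (transport_geodesic M X H)
    (M *m E *m X *m transport_mx M H t *m M +
     M *m transport_mx M H t *m X *m E *m M).
Proof.
move=> E; rewrite [X in is_derive _ _ X]transport_geodesic_quadratic.
apply: (is_derive_eq (is_derive_quadratic_curve _ _ _ t)).
rewrite /quadratic_curve /transport_mx -/E.
move: (invmx M) (E) => N F.
rewrite scaler0 addr0 !(mulmxDr, mulmxDl) -!(scalemxAr, scalemxAl) scalerA.
by rewrite addrACA mulrC mulrDl mul1r scalerDl.
Qed.

Lemma curve_length_transport_geodesic M X H : spd M -> spd X -> spd H ->
  curve_length (gbw_metric M) (transport_geodesic M X H) =
  (Num.sqrt (\tr ((H - invmx M) *m X *m (H - invmx M) *m M)))%:E.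
Proof.
move=> sM sX sH; rewrite /curve_length.
transitivity (\int[mu]_(t in `[0%R, 1%R])
    (Num.sqrt (\tr ((H - invmx M) *m X *m (H - invmx M) *m M)))%:E)%E.
  apply: eq_integral => t; rewrite inE/= in_itv/= => t01; congr (Num.sqrt _)%:E.
  have [_ ->] := is_derive_transport_geodesic M X H t.
  exact: gbw_metric_transport_geodesic.
rewrite integral_cst//= lebesgue_measure_itv/= lte_fin ltr01.
by rewrite -EFinB subr0 mule1.
Qed.

Lemma transport_cost_le_curve_length M X H c : spd M -> spd X -> spd H ->
  spd_curve X (M *m H *m X *m H *m M) c ->
  ((Num.sqrt (\tr ((H - invmx M) *m X *m (H - invmx M) *m M)))%:E <=
    curve_length (gbw_metric M) c)%E.
Proof.
move=> sM sX sH [[s s01 smooth_c] sc c0 c1].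
have [|l [_ il lb]] := transport_length_bound_partition sM sH s01 smooth_c.
  by move=> t t01; apply: sc; rewrite in_itv.
have l0 : 0 <= l.
  by rewrite -lee_fin -il; apply: integral_ge0 => t _; rewrite lee_fin sqrtr_ge0.
(* Starting from age 0, the choice [K = l + e] makes the final age exactly 1. *)
have DE e : 0 < e -> \tr ((H - invmx M) *m X *m (H - invmx M) *m M) <= (l + e) * l.
  move=> e0; have le0 : 0 < l + e by rewrite ltr_wpDl.
  have := lb e (l + e) 0 e0 le0 (lexx _).
  rewrite /= add0r subr0 mulr1 mulVf ?gt_eqF// c0 c1 => /(_ (lexx _)).
  by rewrite transport_cost_potential.
rewrite /curve_length il lee_fin -[leRHS](ger0_norm l0) -sqrtr_sqr ler_wsqrtr//.
apply/ler_addgt0Pr => d d0; have l1 : 0 < l + 1 by rewrite ltr_wpDl.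
(* With [e = d / (l + 1)] the error term [e l] is at most [d]. *)
rewrite (le_trans (DE (d / (l + 1)) _)) ?divr_gt0// mulrDl expr2 lerD2l.
by rewrite mulrAC ler_pdivrMr// ler_pM2l// lerDl.
Qed.

End Geodesic.

(** * The distance formula *)

Theorem proposition7 (R : realType) (n : nat) (M : 'M[R]_n) (hM : spd M)
    (X Y : 'M[R]_n) (hX : spd X) (hY : spd Y) :
  gbw_dist M X Y =
  (Num.sqrt (\tr (invmx M *m X) + \tr (invmx M *m Y)
     - 2 * \tr (principal_sqrt (X *m invmx M *m Y *m invmx M))))%:E.
Proof.
have Mu := spd_unit hM.
have [H sH HXH] : exists2 H, spd H & H *m X *m H = invmx M *m Y *m invmx M.
  apply: riccati_spd => //; rewrite -{1}(spd_tr (spd_inv hM)).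
  by apply: spd_congr; rewrite ?unitmx_inv.
have YE : Y = M *m H *m X *m H *m M.
  have -> : M *m H *m X *m H *m M = M *m (H *m X *m H) *m M by rewrite !mulmxA.
  by rewrite HXH !mulmxA mulmxV// mul1mx mulmxKV.
have -> : principal_sqrt (X *m invmx M *m Y *m invmx M) = X *m H.
  (* The Riccati equation turns [X M^-1 Y M^-1] into [X H X H]. *)
  rewrite -(mulmxA X) -(mulmxA X) -HXH !mulmxA; exact: principal_sqrt_mul_spd.
rewrite [in RHS]YE -transport_costE//.
apply/eqP; rewrite eq_le; apply/andP; split.
- rewrite -curve_length_transport_geodesic//; apply: ereal_inf_lbound.
  exists (transport_geodesic M X H) => //; split.
  + exact: transport_geodesic_smooth.
  + by move=> t; rewrite in_itv/=; exact: transport_geodesic_spd.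
  + exact: transport_geodesic0.
  + by rewrite transport_geodesic1.
- apply/ereal_infP => _ [c Xc <-].
  by apply: transport_cost_le_curve_length; rewrite -?YE.
Qed.
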